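(* Let $\mathcal{C}\subseteq\mathbb{N}^d$ be a positive integer cone, let $T$ be a pseudo-symmetric $\mathcal{C}$-semigroup and let $S=T\cup\{\operatorname{F}(T),\frac{\operatorname{F}(T)}{2}\}$ (a PEPSY-semigroup). If $\frac{\operatorname{F}(T)}{2}\in\operatorname{C}(S)$, then $S$ is primary positioned.
   Context: Let $d\geq 1$. For a finite set $A\subseteq\mathbb{N}^d$, the positive integer cone spanned by $A$ is $\mathcal{C}=\{\sum_{i=1}^n q_ia_i : n\in\mathbb{N}, a_i\in A, q_i\in\mathbb{Q}_{\geq0}\}\cap\mathbb{N}^d$. A $\mathcal{C}$-semigroup is a finitely generated submonoid $S$ of $(\mathbb{N}^d,+)$ with $S\subseteq\mathcal{C}$ and $\mathcal{C}\setminus S$ finite. Put $\mathcal{H}(S)=\mathcal{C}\setminus S$. For $x,y$ write $x\leq_{\mathcal{C}}y$ iff $y-x\in\mathcal{C}$. For $k\in\mathcal{C}$ let $\operatorname{I}_{\mathcal{C}}(k)=\{x\in\mathcal{C}: x\leq_{\mathcal{C}}k\}$. $S$ is $k$-positioned if $k-h\in S$ for every $h\in\mathcal{H}(S)$. Define $\operatorname{C}(S)=\{x\in\mathcal{C}: x\leq_{\mathcal{C}}h\text{ for some }h\in\mathcal{H}(S)\}$ and $\operatorname{M}(S)=\{h\in\mathcal{H}(S): \{s\in S: h-s\in S\}=\{0\}\}\cup\{0\}$. $S$ is primary positioned (for $k$) if there is $k\in\mathcal{C}$ such that $S$ is $k$-positioned and $|\operatorname{M}(S)|+|\operatorname{C}(S)|=|\operatorname{I}_{\mathcal{C}}(k)|$.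 A term order $\preceq$ on $\mathbb{N}^d$ is a total order with $0\preceq v$ for all $v$ and $u\preceq v\Rightarrow u+w\preceq v+w$; $\operatorname{F}_\preceq(S)=\max_\preceq\mathcal{H}(S)$. $\operatorname{PF}(S)=\{x\in\mathcal{H}(S): x+(S\setminus\{0\})\subseteq S\}$. $S$ is pseudo-symmetric if $\operatorname{PF}(S)=\{\operatorname{F}_\preceq(S),\frac{\operatorname{F}_\preceq(S)}{2}\}$ for a term order $\preceq$; then the Frobenius element is independent of the term order and is denoted $\operatorname{F}(S)$.
   Formalization: In the definition of M(S), the condition {s∈S : h−s∈S}={0}, which no gap h satisfies and which makes the claim false, is read as {s∈S : h−s∈C}={0}, i.e. 0 is the only element of S below h for ≤_C. *)

(* Defs.v *)
From mathcomp Require Import all_boot all_order all_algebra finmap.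
From mathcomp Require Import boolp classical_sets cardinality.

Set Implicit Arguments.
Unset Strict Implicit.
Unset Printing Implicit Defensive.

Import GRing.Theory.
Local Open Scope ring_scope.
Local Open Scope classical_set_scope.

(* Elements of N^d are row vectors in 'rV[nat]_d. *)

Definition to_rat (d : nat) (x : 'rV[nat]_d) : 'rV[rat]_d :=
  map_mx (fun m : nat => m%:R) x.

Definition cone (d : nat) (A : {fset 'rV[nat]_d}) : set 'rV[nat]_d :=
  [set x | exists (n : nat) (a : 'I_n -> 'rV[nat]_d) (q : 'I_n -> rat),
    [/\ forall i, a i \in A,
        forall i, 0 <= q i
      & to_rat x = \sum_(i < n) q i *: to_rat (a i)]].

Definition positive_integer_cone (d : nat) (C : set 'rV[nat]_d) : Prop :=
  exists A : {fset 'rV[nat]_d}, C = cone A.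

(* "y - x \in X", the difference being taken in Z^d: since X lies in N^d there
   is no truncation, and in particular x <= y componentwise is implied. *)
Definition sub_in (d : nat) (X : set 'rV[nat]_d) (y x : 'rV[nat]_d) : Prop :=
  exists2 z, X z & x + z = y.

Definition monoid_span (d : nat) (B : {fset 'rV[nat]_d}) : set 'rV[nat]_d :=
  [set x | exists2 s : seq 'rV[nat]_d, {subset s <= B} & x = \sum_(b <- s) b].

Definition gaps (d : nat) (C S : set 'rV[nat]_d) : set 'rV[nat]_d := C `\` S.

Definition C_semigroup (d : nat) (C S : set 'rV[nat]_d) : Prop :=
  [/\ exists B : {fset 'rV[nat]_d}, S = monoid_span B,
      S `<=` C
    & finite_set (gaps C S)].

Definition leC (d : nat) (C : set 'rV[nat]_d) (x y : 'rV[nat]_d) : Prop :=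
  sub_in C y x.

Definition I_C (d : nat) (C : set 'rV[nat]_d) (k : 'rV[nat]_d) :
    set 'rV[nat]_d :=
  [set x | C x /\ leC C x k].

Definition positioned (d : nat) (C S : set 'rV[nat]_d) (k : 'rV[nat]_d) : Prop :=
  forall h, gaps C S h -> sub_in S k h.

Definition C_of (d : nat) (C S : set 'rV[nat]_d) : set 'rV[nat]_d :=
  [set x | C x /\ exists2 h, gaps C S h & leC C x h].

(* The condition on h is {s \in S : h - s \in C} = {0}, i.e. 0 is the only
   element of S below h for <=_C.  Asking for h - s \in S instead would make
   it unsatisfiable, since s = 0 would then give h \in S. *)
Definition M_of (d : nat) (C S : set 'rV[nat]_d) : set 'rV[nat]_d :=
  [set h | gaps C S h /\ [set s | S s /\ leC C s h] = [set 0]] `|` [set 0].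

(* fset_set is meaningful here: when gaps C S is finite, M_of C S and C_of C S
   are finite, and I_C C k always is, being bounded componentwise by k. *)
Definition primary_positioned (d : nat) (C S : set 'rV[nat]_d) : Prop :=
  exists k, [/\ C k,
    positioned C S k
  & (#|` fset_set (M_of C S)| + #|` fset_set (C_of C S)|)%N
      = #|` fset_set (I_C C k)| ].

Definition term_order (d : nat) (le : rel 'rV[nat]_d) : Prop :=
  [/\ [/\ reflexive le, antisymmetric le, transitive le & total le],
      forall v, le 0 v
    & forall u v w, le u v -> le (u + w) (v + w)].

Definition is_Frobenius (d : nat) (le : rel 'rV[nat]_d) (C S : set 'rV[nat]_d)
    (f : 'rV[nat]_d) : Prop :=
  gaps C S f /\ forall h, gaps C S h -> le h f.

Definition PF (d : nat) (C S : set 'rV[nat]_d) : set 'rV[nat]_d :=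
  [set x | gaps C S x /\ forall s, S s -> s <> 0 -> S (x + s)].

(* g stands for f / 2. *)
Definition pseudo_symmetric (d : nat) (C S : set 'rV[nat]_d) : Prop :=
  exists (le : rel 'rV[nat]_d) (f g : 'rV[nat]_d),
    [/\ term_order le, is_Frobenius le C S f, g *+ 2 = f
      & PF C S = [set f; g]].

(* Main.v *)
Require Import Defs.
From mathcomp Require Import all_boot all_order all_algebra finmap.
From mathcomp Require Import boolp classical_sets cardinality.

(* Take k = F. Every gap h <> F/2 of T satisfies F - h \in T: h lies below a
   pseudo-Frobenius element, F or F/2, and if h + s = F/2 with s \in T nonzero
   then F - h = F/2 + s \in T. Hence S is F-positioned, and x |-> F - x maps M(S)
   bijectively onto the complement of C(S) in I_C(F): for y = F - x, a nonzero
   s \in S below y gives the gap F - s above x, and a gap h above x gives the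
   element F - h of S below y. The hypothesis F/2 \in C(S) handles the case
   s = F/2, where F - s is not a gap of S but x <= F/2. *)

Set Implicit Arguments.
Unset Strict Implicit.
Unset Printing Implicit Defensive.

Import GRing.Theory.
Local Open Scope ring_scope.
Local Open Scope classical_set_scope.

Lemma rowD_inj (d : nat) (x : 'rV[nat]_d) : injective (+%R x).
Proof.
move=> y z /matrixP e; apply/matrixP => i j.
by have := e i j; rewrite !mxE => /addnI.
Qed.

Lemma row_double_inj (d : nat) : injective (fun x : 'rV[nat]_d => x *+ 2).
Proof.
move=> x y /matrixP e; apply/matrixP => i j.
have := e i j; rewrite !mulr2n !mxE.
change (x i j + x i j = y i j + y i j -> x i j = y i j)%N.
by rewrite !addnn => /double_inj.
Qed.

Lemma rowD_eq0 (d : nat) (x y : 'rV[nat]_d) : x + y = 0 -> x = 0.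
Proof.
move=> /matrixP e; apply/matrixP => i j; have := e i j; rewrite !mxE.
by change (x i j + y i j = 0 -> x i j = 0)%N; case: (x i j).
Qed.

(** Each entry of such an [x] is at most the entry sum [N] of [F], so [x] comes from a row over the
    finite type ['I_N.+1]. *)
Lemma finite_row_below (d : nat) (F : 'rV[nat]_d) :
  finite_set [set x | exists z, x + z = F].
Proof.
pose N := (\sum_i \sum_j F i j)%N.
pose f (m : 'rV['I_N.+1]_d) : 'rV[nat]_d := map_mx (@nat_of_ord _) m.
apply: (@sub_finite_set _ _ (f @` setT)); last exact/finite_image/finite_finset.
move=> x [z /matrixP e] /=; exists (map_mx inord x) => //.
apply/matrixP => i j; rewrite !mxE inordK // ltnS.
have : (x i j <= F i j)%N by rewrite -e mxE; exact: leq_addr.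
move/leq_trans; apply.
by rewrite /N (bigD1 i) //= (bigD1 j) //= -addnA leq_addr.
Qed.

Lemma cone0 (d : nat) (C : set 'rV[nat]_d) : positive_integer_cone C -> C 0.
Proof.
move=> [A ->]; exists 0%N, (fun=> 0), (fun=> 0); split => [[]//|[]//|].
by rewrite big_ord0; apply/matrixP => i j; rewrite !mxE.
Qed.

Lemma coneD (d : nat) (C : set 'rV[nat]_d) (x y : 'rV[nat]_d) :
  positive_integer_cone C -> C x -> C y -> C (x + y).
Proof.
move=> [A ->] [n [a [q [aA q0 ex]]]] [m [b [r [bA r0 ey]]]].
exists (n + m)%N,
  (fun i => match fintype.split i with inl j => a j | inr j => b j end),
  (fun i => match fintype.split i with inl j => q j | inr j => r j end); split.
- by move=> i; case: fintype.split.
- by move=> i; case: fintype.split.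
- rewrite big_split_ord /=.
  have -> : to_rat (x + y) = to_rat x + to_rat y.
    by apply/matrixP => i j; rewrite !mxE natrD.
  rewrite ex ey; congr (_ + _); apply: eq_bigr => i _.
    by rewrite (unsplitK (inl _ i)).
  by rewrite (unsplitK (inr _ i)).
Qed.

Lemma monoid_span0 (d : nat) (B : {fset 'rV[nat]_d}) : monoid_span B 0.
Proof. by exists [::]; rewrite ?big_nil. Qed.

Lemma monoid_spanD (d : nat) (B : {fset 'rV[nat]_d}) (x y : 'rV[nat]_d) :
  monoid_span B x -> monoid_span B y -> monoid_span B (x + y).
Proof.
move=> [s sB ->] [t tB ->]; exists (s ++ t); last by rewrite big_cat.
by move=> z; rewrite mem_cat => /orP[/sB|/tB].
Qed.

Lemma finite_rows_bounded (d : nat) (X : set 'rV[nat]_d) : finite_set X ->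
  exists b, forall x, X x -> (\sum_i \sum_j x i j <= b)%N.
Proof.
move=> fX; exists (\sum_(x <- fset_set X) \sum_i \sum_j x i j)%N => x Xx.
by rewrite (big_fsetD1 x) /= ?leq_addr// in_fset_set// inE.
Qed.

(* Every gap lies below a pseudo-Frobenius element, because a gap [h + s] of
   maximal weight with [s] in [T] is pseudo-Frobenius. *)
Lemma gap_below_PF (d : nat) (C T : set 'rV[nat]_d) (h : 'rV[nat]_d) :
  positive_integer_cone C -> C_semigroup C T -> gaps C T h ->
  exists2 s, T s & PF C T (h + s).
Proof.
move=> hC [[B TB] TC fin].
have T0 : T 0 by rewrite TB; exact: monoid_span0.
have TD x y : T x -> T y -> T (x + y) by rewrite TB; exact: monoid_spanD.
have [b hb] := finite_rows_bounded fin.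
pose w (x : 'rV[nat]_d) := (\sum_i \sum_j x i j)%N.
have wD x y : w (x + y) = (w x + w y)%N.
  rewrite /w -big_split; apply: eq_bigr => i _.
  by rewrite -big_split; apply: eq_bigr => j _; rewrite mxE.
have w0 x : w x = 0%N -> x = 0.
  move/eqP; rewrite sum_nat_eq0 => /forallP e.
  apply/matrixP => i j; have := e i; rewrite sum_nat_eq0 => /forallP /(_ j).
  by rewrite mxE => /eqP.
have [n] := ubnP (b - w h)%N; elim: n h => // n IH h hn gh.
have [ph|nph] := pselect (PF C T h); first by exists 0; rewrite ?addr0.
have [s [Ts s0 nT]] : exists s, [/\ T s, s <> 0 & ~ T (h + s)].
  apply: contrapT => H; apply: nph; split => // s Ts s0.
  by apply: contrapT => nT; apply: H; exists s.
have ghs : gaps C T (h + s).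
  by split => //; apply: coneD => //; [case: gh | exact: TC].
have ws : (0 < w s)%N by rewrite lt0n; apply/eqP => /w0.
have bhs : (w (h + s)%R <= b)%N by exact: hb.
have [|t Tt pt] := IH (h + s) _ ghs.
  (* Subtraction is truncated, so the strict decrease needs [w h < b]; this holds because the gap
     [h + s] is heavier than [h] and has weight at most [b]. *)
  rewrite wD in bhs *; rewrite ltnS in hn; apply: leq_trans hn.
  by apply: ltn_sub2l; rewrite -[X in (X < _)%N]addn0 ?ltn_add2l //;
    apply: leq_trans bhs; rewrite ltn_add2l.
by exists (s + t); [exact: TD | rewrite addrA].
Qed.

Lemma pseudo_symmetric_gap (d : nat) (C T : set 'rV[nat]_d)
    (f g h : 'rV[nat]_d) :
  positive_integer_cone C -> C_semigroup C T -> g *+ 2 = f ->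
  PF C T = [set f; g] -> gaps C T h -> h <> g -> sub_in T f h.
Proof.
move=> hC hT gf ePF gh hg.
have [s Ts] := gap_below_PF hC hT gh; rewrite ePF => -[/= e|/= e].
  by exists s.
(* Here [h + s = g], so [f - h = g + s]. It lies in [T] because [g] is pseudo-Frobenius and [h <> g]
   forces [s <> 0]. *)
exists (g + s); last by rewrite addrCA e -gf mulr2n.
have : PF C T g by rewrite ePF; right.
by move=> [_]; apply => // s0; apply: hg; rewrite -e s0 addr0.
Qed.

(** This transfers pseudo-symmetry to an arbitrary term order. As [f] is a gap, [f] is at most [F];
    conversely [F] is componentwise below [f], either because [F = g] or because [f - F] lies in
    [T]. *)
Lemma pseudo_symmetric_FrobeniusE (d : nat) (C T : set 'rV[nat]_d)
    (le : rel 'rV[nat]_d) (F f g : 'rV[nat]_d) :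
  positive_integer_cone C -> C_semigroup C T -> term_order le ->
  is_Frobenius le C T F -> g *+ 2 = f -> PF C T = [set f; g] -> F = f.
Proof.
move=> hC hT [[_ asym _ _] le0 leD] [gF maxF] gf ePF.
have leDr x z : le x (x + z) by rewrite -{1}[x]add0r [x + z]addrC; exact: leD.
have gapf : gaps C T f by have [] : PF C T f by rewrite ePF; left.
apply: asym; rewrite maxF // andbT.
have [->|nFg] := pselect (F = g); first by rewrite -gf mulr2n.
by have [z _ <-] := pseudo_symmetric_gap hC hT gf ePF gF nFg.
Qed.

Theorem theorem3p5 (d : nat) (hd : (1 <= d)%N)
    (C : set 'rV[nat]_d) (hC : positive_integer_cone C)
    (T : set 'rV[nat]_d) (hT : C_semigroup C T) (psT : pseudo_symmetric C T)
    (le : rel 'rV[nat]_d) (hle : term_order le)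
    (F : 'rV[nat]_d) (hF : is_Frobenius le C T F)
    (G : 'rV[nat]_d) (hG : G *+ 2 = F)
    (S : set 'rV[nat]_d) (hS : S = T `|` [set F; G])
    (hCS : C_of C S G) :
  primary_positioned C S.
Proof.
have [[B TB] TC finT] := hT.
have T0 : T 0 by rewrite TB; exact: monoid_span0.
have TD x y : T x -> T y -> T (x + y) by rewrite TB; exact: monoid_spanD.
have C0 := cone0 hC; have CD x y := @coneD _ C x y hC.
have [_ [f [g [_ _ gf ePF]]]] := psT.
have eF := pseudo_symmetric_FrobeniusE hC hT hle hF gf ePF.
rewrite -eF in gf ePF.
have eG : G = g by apply: row_double_inj; rewrite hG gf.
rewrite -eG in gf ePF.
have refl := pseudo_symmetric_gap hC hT gf ePF.
have [gF _] := hF.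
have gG : gaps C T G by have [] : PF C T G by rewrite ePF; right.
have gS h : gaps C S h <-> [/\ gaps C T h, h <> F & h <> G].
  rewrite hS; split=> [[Ch nS]|[[Ch nT] hF' hG']].
    split; first by split => // Th; apply: nS; left.
    - by move=> e; apply: nS; right; left.
    - by move=> e; apply: nS; right; right.
  by split => // -[//|[]].
have posS h : gaps C S h -> sub_in T F h by move=> /gS[gh _ /(refl h gh)].
have TF x y : T x -> x + y = F -> C y -> gaps C T y.
  move=> Tx e Cy; split => // Ty; case: gF => _; apply.
  by rewrite -e; exact: TD.
have CS_down x y : C x -> leC C x y -> C_of C S y -> C_of C S x.
  move=> Cx [z Cz <-] [_ [h gh [w Cw e]]]; split => //; exists h => //.
  by exists (z + w); [exact: CD | rewrite addrA].
(* A gap [h] of [S] above [F] is also below [F], hence equals [F], which is in [S]. *)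
have nCF : ~ C_of C S F.
  move=> [_ [h /[dup] /posS[z _ e] /gS[_ hnF _] [w _ e']]]; apply: hnF.
  have zw : w + z = 0 by apply: (@rowD_inj _ F); rewrite addrA e' addr0.
  by rewrite -e' (rowD_eq0 zw) addr0.
(* The hypothesis on [G] supplies a gap of [S]; for [S = C] the set [C_of C S] would be empty. *)
have C0S : C_of C S 0.
  by apply: CS_down hCS => //; exists G; [case: gG | rewrite add0r].
(* The subtraction is truncated, so [r] is [F - x] only for [x] below [F]; [rE] is applied only
   there. *)
pose r (x : 'rV[nat]_d) : 'rV[nat]_d := map2_mx subn F x.
have rE x y : x + y = F -> r x = y.
  by rewrite /r => <-; apply/matrixP => i j; rewrite !mxE addKn.
have M_F y : M_of C S y -> exists x, [/\ y + x = F, C x & ~ C_of C S x].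
  move=> [[gy My]|->]; last by exists F; rewrite add0r; case: gF.
  have [x Tx e] := posS _ gy; exists x; split => //; first exact: TC.
  move=> [_ [h gh [w Cw e']]].
  have [t Tt et] := posS _ gh.
  (* With [h = x + w] and [t = F - h], one gets [t + w = y]. Minimality of [y] then forces [t = 0],
     that is [h = F], which is not a gap of [S]. *)
  have : [set s | S s /\ leC C s y] t.
    split; first by rewrite hS; left.
    exists w => //; apply: (@rowD_inj _ x).
    by rewrite [t + w]addrC addrA e' et addrC e.
  rewrite My /= => t0; have [_ + _] := (gS h).1 gh; apply.
  by rewrite -et t0 addr0.
have F_M x y : C x -> C y -> x + y = F -> ~ C_of C S x -> M_of C S y.
  move=> Cx Cy e nx.
  have [xF|xF] := pselect (x = F).
    by right; apply: (@rowD_inj _ x); rewrite e addr0 xF.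
  left.
  have xG : x <> G by move=> xG; apply: nx; rewrite xG.
  have x0 : x <> 0 by move=> x0; apply: nx; rewrite x0.
  have Tx : T x.
    (* Otherwise [x] would itself be a gap of [S], and so lie in [C_of C S]. *)
    apply: contrapT => nT; apply: nx; split => //; exists x.
      by apply/gS; split.
    by exists 0; rewrite ?addr0.
  have yF : y <> F.
    by move=> yF; apply: x0; apply: (@rowD_inj _ y); rewrite addr0 addrC e.
  have yG : y <> G.
    move=> yG; apply: xG; apply: (@rowD_inj _ y).
    by rewrite addrC e yG -hG mulr2n.
  split; first by apply/gS; split => //; exact: TF e Cy.
  apply/seteqP; split => [s [Ss [z Cz es]]|s ->]; last first.
    by split; [rewrite hS; left | exists y; rewrite ?add0r].
  apply: contrapT => /= s0.
  have exz : s + (x + z) = F by rewrite addrCA es.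
  have lexz : leC C x (x + z) by exists z.
  (* The element [x + z = F - s] lies above [x]. It is a gap of [S] if [s] is in [T], it is [0] if
     [s = F], and it is [G], in [C_of C S] by hypothesis, if [s = G]. *)
  move: Ss; rewrite hS => -[Ts|[/= sF|/= sG]].
  - have gxz : gaps C T (x + z) by apply: TF exz _ => //; exact: CD.
    apply: nx; split => //; exists (x + z) => //; apply/gS; split => // e'.
    + apply: s0; apply: (@rowD_inj _ (x + z)).
      by rewrite addr0 addrC exz e'.
    + case: gG => _; apply; suff <- : s = G by [].
      apply: (@rowD_inj _ (x + z)).
      by rewrite addrC exz e' -hG mulr2n.
  - apply: x0; apply: (@rowD_eq0 _ _ z); apply: (@rowD_inj _ s).
    by rewrite exz sF addr0.
  - apply: nx; apply: CS_down lexz _ => //; suff -> : x + z = G by [].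
    by apply: (@rowD_inj _ s); rewrite exz sG -hG mulr2n.
(* [fset_set] sends infinite sets to [fset0], so finiteness must precede any counting. *)
have finI := finite_row_below F.
have finC : finite_set (C_of C S).
  apply: sub_finite_set finI => x [_ [h /posS[t _ e] [z _ e']]] /=.
  by exists (z + t); rewrite addrA e'.
have finM : finite_set (M_of C S).
  by apply: sub_finite_set finI => y /M_F[x [e _ _]]; exists x.
have CM y : M_of C S y -> C y by move=> [[[]]|->].
have IE : I_C C F = C_of C S `|` r @` M_of C S.
  apply/seteqP; split => x.
    move=> [Cx [y Cy e]].
    have [|nx] := pselect (C_of C S x); [by left | right].
    by exists y; [exact: F_M nx | apply: rE; rewrite addrC].
  move=> [[Cx [h gh [z Cz e]]]|[y My <-]].
    have [t Tt et] := posS _ gh; split => //; exists (z + t).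
      by apply: CD => //; exact: TC.
    by rewrite addrA e.
  have [x' [e Cx' _]] := M_F _ My; rewrite (rE _ _ e); split => //.
  by exists y; [exact: CM | rewrite addrC].
exists F; split; first by case: gF.
  by move=> h /posS[t Tt e]; exists t => //; rewrite hS; left.
have finrM : finite_set (r @` M_of C S) by exact: finite_image.
rewrite IE (fset_setU finC finrM) (fset_set_image _ finM) cardfsU.
(* The union is disjoint: by [M_F], [F - y] is outside [C_of C S] for [y] in [M_of C S]. Injectivity
   of [r] on [M_of C S] then yields the count. *)
set I := (_ `&` _)%fset; have -> : I = fset0.
  apply/fsetP => x; rewrite !inE; apply/negP => /andP[].
  rewrite in_fset_set // inE => Cx /imfsetP[/= y].
  rewrite in_fset_set // inE => /M_F[x' [e _ nx']] ex.
  by apply: nx'; rewrite -(rE _ _ e) -ex.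
rewrite cardfs0 subn0 addnC card_in_imfset //= => y y'.
rewrite !in_fset_set // !inE => /M_F[x [e _ _]] /M_F[x' [e' _ _]].
rewrite (rE _ _ e) (rE _ _ e') => exx; apply: (@rowD_inj _ x).
by rewrite addrC e exx addrC e'.
Qed.
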